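(* Let $k>1$ and let $\{a_n\}_{n=0}^{\infty}$ be a non-degenerate linear recurrence sequence of integers of order $k$, satisfying $$a_{n+k}=r_1a_{n+k-1}+\cdots+r_ka_n\qquad (n=0,1,2,\dots),$$ where $r_1,\dots,r_k\in\mathbb{Z}$ and $r_k\neq 0$. Then $\{a_n\}_{n=0}^{\infty}$ has infinitely many prime divisors.
   Context: A sequence of integers $\{a_n\}_{n=0}^{\infty}$ is a linear recurrence sequence if it satisfies, for some $k$, a relation $a_{n+k}=r_1a_{n+k-1}+\cdots+r_ka_n$ for all $n\geq 0$, with constants $r_1,\dots,r_k\in\mathbb{Z}$ and $r_k\neq 0$. Its order always means the minimal $k$ for which such a relation exists, and the recurrence relation considered is the one of this minimal order. Its characteristic polynomial is $g(x)=1-\sum_{i=1}^k r_ix^i$. The sequence is called degenerate if its characteristic polynomial has two distinct (complex) roots whose ratio is a root of unity, and non-degenerate otherwise. A prime $p$ is called a prime divisor of $\{a_n\}_{n=0}^{\infty}$ if $p\mid a_n$ for some $n$. *)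

(* Defs.v *)
From HB Require Import structures.
From mathcomp Require Import all_boot all_order all_algebra all_field.
From mathcomp Require Import classical_sets cardinality.

Set Implicit Arguments.
Unset Strict Implicit.
Unset Printing Implicit Defensive.

Import Order.TTheory GRing.Theory Num.Theory.

Local Open Scope ring_scope.

(* The coefficients r_1, ..., r_k are the values r 1, ..., r k; the other
   values of r are irrelevant.  All indices n + k - i below have i <= k, so the
   truncation of the subtraction plays no role. *)
Definition satisfies_recurrence (a : nat -> int) (k : nat) (r : nat -> int)
    : Prop :=
  [/\ (0 < k)%N, r k != 0
    & forall n : nat,
        a (n + k)%N = \sum_(1 <= i < k.+1) r i * a (n + k - i)%N].

Definition minimal_recurrence (a : nat -> int) (k : nat) (r : nat -> int)
    : Prop :=
  satisfies_recurrence a k r /\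
  forall (k' : nat) (r' : nat -> int),
    satisfies_recurrence a k' r' -> (k <= k')%N.

Definition recurrence_poly (k : nat) (r : nat -> int) : {poly int} :=
  1 - \sum_(1 <= i < k.+1) r i *: 'X^i.

(* [n.-unity_root] holds of everything for n = 0, hence the condition 0 < n. *)
Definition is_root_of_unity (z : algC) : Prop :=
  exists2 n : nat, (0 < n)%N & n.-unity_root z.

(* The complex roots of an integer polynomial are algebraic, so that they are
   all found in algC. *)
Definition degenerate_poly (g : {poly int}) : Prop :=
  exists x y : algC,
    [/\ root (map_poly intr g) x, root (map_poly intr g) y, x != y
      & is_root_of_unity (x / y)].

Definition degenerate (a : nat -> int) : Prop :=
  exists (k : nat) (r : nat -> int),
    minimal_recurrence a k r /\ degenerate_poly (recurrence_poly k r).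

Definition prime_divisor (a : nat -> int) (p : nat) : Prop :=
  prime p /\ exists n : nat, (p%:Z %| a n)%Z.

(* Main.v *)
Require Import Defs.
From HB Require Import structures.
From mathcomp Require Import all_boot all_order all_algebra all_field.
From mathcomp Require Import classical_sets cardinality.
From mathcomp Require Import zify ring.

Set Implicit Arguments.
Unset Strict Implicit.
Unset Printing Implicit Defensive.

Import Order.TTheory GRing.Theory Num.Theory.

Local Open Scope ring_scope.

(* Suppose only the primes p_1, ..., p_s divide terms of the sequence.  Fix p and
   let mu be the first slope of the p-adic Newton polygon of the recurrence.
   After division by p^(floor (mu n)) the sequence is p-integral with a periodic
   recurrence, hence eventually periodic modulo every power of p; it does not
   tend to 0 p-adically along any progression of step P, since otherwise all
   roots of the characteristic polynomial would have p-adic valuation greater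
   than mu.  The latter step inverts the matrix (a_(P m + i)), which is
   nonsingular because x |-> x^P is injective on the characteristic roots.  So
   every progression contains a subprogression along which the valuation at p is
   affine, and treating p_1, ..., p_s in turn yields one along which |a_n| is
   geometric.  Reduction modulo one further prime l > 2 fixes the signs, and then
   the characteristic polynomial divides X^n0 (c0 X^P - c1), against k > 1 and
   nondegeneracy. *)

(** * Polynomials in the shift operator *)

(* The polynomial p in the shift operator u |-> u o S, applied to u. *)
Definition act (R : comNzRingType) (p : {poly R}) (u : nat -> R) (n : nat) : R :=
  \sum_(i < size p) p`_i * u (n + i)%N.

Lemma act_widen (R : comNzRingType) (p : {poly R}) u n m :
  (size p <= m)%N -> act p u n = \sum_(i < m) p`_i * u (n + i)%N.
Proof.
move=> le_pm; rewrite /act (big_ord_widen _ (fun i => p`_i * u (n + i)%N) le_pm).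
rewrite big_mkcond; apply: eq_bigr => i _; case: ltnP => // le_pi.
by rewrite nth_default ?mul0r.
Qed.

Lemma actD (R : comNzRingType) (p q : {poly R}) u n :
  act (p + q) u n = act p u n + act q u n.
Proof.
set m := maxn (size p) (size q).
rewrite (act_widen u n (size_polyD p q)) (act_widen u n (leq_maxl _ _ : _ <= m)%N).
rewrite (act_widen u n (leq_maxr _ _ : _ <= m)%N) -big_split /=.
by apply: eq_bigr => i _; rewrite coefD mulrDl.
Qed.

Lemma actZ (R : comNzRingType) c (p : {poly R}) u n :
  act (c *: p) u n = c * act p u n.
Proof.
rewrite (act_widen u n (size_scale_leq c p)) mulr_sumr.
by apply: eq_bigr => i _; rewrite coefZ mulrA.
Qed.

Lemma act0 (R : comNzRingType) (u : nat -> R) n : act 0 u n = 0.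
Proof. by rewrite -(scale0r 0) actZ mul0r. Qed.

Lemma actN (R : comNzRingType) (p : {poly R}) u n : act (- p) u n = - act p u n.
Proof. by rewrite -scaleN1r actZ mulN1r. Qed.

Lemma act_sum (R : comNzRingType) (I : Type) (s : seq I) (P : pred I)
    (F : I -> {poly R}) u n :
  act (\sum_(i <- s | P i) F i) u n = \sum_(i <- s | P i) act (F i) u n.
Proof.
by apply: (big_morph (fun p => act p u n)) => [p q|]; rewrite ?actD ?act0.
Qed.

Lemma actXn (R : comNzRingType) m (u : nat -> R) n : act 'X^m u n = u (n + m)%N.
Proof.
rewrite /act size_polyXn big_ord_recr /= coefXn eqxx mul1r big1 ?add0r // => i _.
by rewrite coefXn ltn_eqF // mul0r.
Qed.

Lemma act1 (R : comNzRingType) (u : nat -> R) n : act 1 u n = u n.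
Proof. by rewrite -(expr0 'X) actXn addn0. Qed.

Lemma act_eq (R : comNzRingType) (p : {poly R}) u v n :
  u =1 v -> act p u n = act p v n.
Proof. by move=> eq_uv; apply: eq_bigr => i _; rewrite eq_uv. Qed.

(** Induction on [p]: a factor ['X] amounts to a shift of the index. *)
Lemma actM (R : comNzRingType) (p q : {poly R}) u n :
  act (p * q) u n = act p (act q u) n.
Proof.
have actMX (t : {poly R}) v m : act (t * 'X) v m = act t v m.+1.
  rewrite (act_widen _ _ (leq_trans (size_polyMleq _ _) _ : _ <= (size t).+1)%N).
    rewrite big_ord_recl coefMX eqxx mul0r add0r.
    by apply: eq_bigr => i _; rewrite coefMX /= addnS addSn.
  by rewrite size_polyX addn2.
elim/poly_ind: p n => [|p c IHp] n; first by rewrite mul0r !act0.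
rewrite mulrDl -mulrA -(commr_polyX q) mulrA !actD !actMX IHp.
by rewrite mul_polyC -[c%:P]alg_polyC !actZ act1.
Qed.

Lemma act_mull_eq0 (R : comNzRingType) (p q : {poly R}) u :
  act q u =1 (fun=> 0) -> act (p * q) u =1 (fun=> 0).
Proof.
move=> qu0 n; rewrite actM (act_eq _ _ qu0) /act big1 // => i _.
by rewrite mulr0.
Qed.

(** * The characteristic polynomial and the minimality of the order *)

(** The reciprocal of [recurrence_poly k r], with inverse roots. Being monic, it allows division
    with remainder over the integers. *)
Definition charpol (k : nat) (r : nat -> int) : {poly int} :=
  'X^k - \sum_(1 <= i < k.+1) r i *: 'X^(k - i).

Lemma size_charpol_tail k (r : nat -> int) :
  (size (\sum_(1 <= i < k.+1) r i *: 'X^(k - i))%R <= k)%N.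
Proof.
rewrite big_nat; apply: (leq_trans (size_sum _ _ _)); apply/bigmax_leqP_seq.
move=> i _ /andP[i_gt0 le_ik]; apply: leq_trans (size_scale_leq _ _) _.
by rewrite size_polyXn; lia.
Qed.

Lemma size_charpol k r : size (charpol k r) = k.+1.
Proof.
by rewrite size_polyDl size_polyXn // size_polyN ltnS size_charpol_tail.
Qed.

Lemma charpol_monic k r : charpol k r \is monic.
Proof.
rewrite monicE lead_coefDl ?lead_coefXn //.
by rewrite size_polyN size_polyXn ltnS size_charpol_tail.
Qed.

Lemma coef_charpol k r i : (0 < i <= k)%N -> (charpol k r)`_(k - i) = - r i.
Proof.
case/andP=> i_gt0 le_ik; rewrite coefB coefXn coef_sum.
rewrite (_ : (k - i == k)%N = false) ?sub0r; last by apply/eqP; lia.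
rewrite big_nat (big_rem i) ?mem_index_iota ?ltnS ?i_gt0 //= le_ik.
rewrite coefZ coefXn eqxx mulr1 big1_seq ?addr0 // => j /andP[/andP[j_gt0 le_jk]].
rewrite mem_rem_uniq ?iota_uniq // inE => /andP[/eqP ne_ji _].
by rewrite coefZ coefXn (_ : (_ == _) = false) ?mulr0 //; apply/eqP; lia.
Qed.

Lemma act_charpol a k r n :
  satisfies_recurrence a k r -> act (charpol k r) a n = 0.
Proof.
case=> _ _ rec_a; rewrite actD actN act_sum actXn rec_a.
apply/eqP; rewrite subr_eq0; apply/eqP; apply: eq_big_nat => i /andP[_ le_ik].
by rewrite actZ actXn addnBA.
Qed.

Lemma recurrence_of_annihilator (p : {poly int}) (a : nat -> int) :
    p \is monic -> p`_0 != 0 -> (1 < size p)%N -> act p a =1 (fun=> 0) ->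
  satisfies_recurrence a (size p).-1 (fun i => - p`_((size p).-1 - i)).
Proof.
move=> /monicP mon_p nz_p0 size_p pa0; set d := (size p).-1.
have Dp : size p = d.+1 by rewrite prednK // ltnW.
split; [by lia | by rewrite subnn oppr_eq0 | move=> n].
have /eqP := pa0 n; rewrite /act Dp big_ord_recr /= -/(lead_coef p) mon_p mul1r.
rewrite addrC addr_eq0 => /eqP ->; rewrite big_add1 big_mkord /= -sumrN.
rewrite (reindex_inj rev_ord_inj) /=; apply: eq_bigr => i _.
by rewrite mulNr addnBA.
Qed.

(** On integer polynomials [%|] is divisibility up to a nonzero constant factor. For monic [p] it is
    exact, because [p] then divides a remainder shorter than itself. *)
Lemma monic_dvdp_rmodp (p q : {poly int}) :
  p \is monic -> p %| q -> Pdiv.Ring.rmodp q p = 0.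
Proof.
move=> mon_p; rewrite [q in _ %| q](Pdiv.RingMonic.rdivp_eq mon_p).
rewrite dvdp_addr ?dvdp_mull // => p_dv.
have := Pdiv.Ring.ltn_rmodp q p; rewrite monic_neq0 // => lt_qp.
by apply: contraTeq lt_qp => nz_q; rewrite -leqNgt dvdp_leq.
Qed.

(* Gauss's lemma makes the gcd of h and the characteristic polynomial an
   integral monic annihilator, so minimality among integral recurrences is
   minimality over the rationals. *)
Lemma annihilator_mod_charpol a k r (h : {poly int}) :
    (1 < k)%N -> minimal_recurrence a k r -> act h a =1 (fun=> 0) ->
  Pdiv.Ring.rmodp h (charpol k r) = 0.
Proof.
move=> k_gt1 [rec_a min_a] ha0; set chi := charpol k r.
have mon_chi : chi \is monic := charpol_monic k r.
have nz_chi : chi != 0 := monic_neq0 mon_chi.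
apply: monic_dvdp_rmodp => //.
set d := gcdp h chi; have d_chi : d %| chi := dvdp_gcdr h chi.
have nz_d : d != 0 by rewrite gcdp_eq0 negb_and nz_chi orbT.
have da0 : act d a =1 (fun=> 0).
  (* Over the integers the Bezout identity holds only up to nonzero constants [c1] and [c2]. *)
  have [[u v] /= /eqpP[[c1 c2] /= /andP[nz1 nz2] Duv]] := Bezoutp h chi.
  move=> n; apply/eqP; rewrite -(mulrI_eq0 _ (lregP nz2)) -actZ -Duv actZ actD.
  rewrite (act_mull_eq0 _ ha0) (act_mull_eq0 _ _) ?addr0 ?mulr0 // => m.
  exact: act_charpol.
have [t Dchi] := dvdpP_int d_chi; set p := zprimitive d in Dchi.
have pa0 : act p a =1 (fun=> 0).
  move=> n; apply/eqP; have := da0 n.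
  rewrite [d]zpolyEprim actZ => /eqP; rewrite mulf_eq0 zcontents_eq0.
  by rewrite (negPf nz_d).
have size_p : size p = size d := size_zprimitive d.
(* As [chi] is monic, the leading coefficient of its factor [p] is 1 or -1. *)
pose eps := lead_coef p; have lead_pt : eps * lead_coef t = 1.
  by rewrite -lead_coefM -Dchi; apply/eqP; rewrite -monicE.
have eps2 : eps * eps = 1.
  have /eqP := congr1 absz lead_pt; rewrite abszM muln_eq1 => /andP[/eqP eps1 _].
  by case: (eps) eps1 => -[|[|]].
have nz_eps : eps != 0 by apply/eqP => eps0; move: eps2; rewrite eps0 mul0r.
pose q := eps *: p; have qa0 : act q a =1 (fun=> 0).
  by move=> n; rewrite actZ pa0 mulr0.
have mon_q : q \is monic by rewrite monicE lead_coefZ -/eps eps2.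
have size_q : size q = size d.
  by rewrite size_scale ?size_p.
have nz_q0 : q`_0 != 0.
  have [_ nz_rk _] := rec_a; move: nz_rk; rewrite -oppr_eq0.
  rewrite -(@coef_charpol k) ?leqnn ?andbT ?(ltnW k_gt1) // subnn -/chi Dchi.
  rewrite coef0M mulf_eq0 negb_or => /andP[nz_p0 _].
  by rewrite coefZ mulf_neq0.
suff: (size chi <= size d)%N.
  move=> le_chi; have : d %= chi.
    by rewrite -dvdp_size_eqp // eqn_leq le_chi (dvdp_leq nz_chi d_chi).
  by move=> /eqp_dvdl <-; apply: dvdp_gcdl.
(* If [q] is constant, it is 1 and [a] vanishes; then [a] has a recurrence of order 1, against
   [k > 1]. *)
rewrite size_charpol -size_q; have [le_q1|] := leqP (size q) 1.
  have a0 n : a n = 0.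
    have Dq : q = 1.
      by have := monicP mon_q; rewrite (size1_polyC le_q1) lead_coefC => ->.
    by rewrite -(qa0 n) Dq act1.
  have /min_a : satisfies_recurrence a 1 (fun=> 1).
    by split=> // n; rewrite big_nat1 !a0 mulr0.
  by rewrite leqNgt k_gt1.
move=> size_q1; have := min_a _ _ (recurrence_of_annihilator mon_q nz_q0 size_q1 qa0).
by move=> le_k; rewrite -(prednK (ltnW size_q1)) ltnS.
Qed.

(** * Characteristic roots and their powers *)

Lemma coprimep_prod_XsubC (F : fieldType) (s : seq F) (q : {poly F}) :
  {in s, forall z, ~~ root q z} -> coprimep (\prod_(z <- s) ('X - z%:P)) q.
Proof.
move=> nroot_q; rewrite big_seq.
apply: (big_ind (fun p => coprimep p q)) => [|p1 p2 cop1 cop2|z s_z].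
- exact: coprime1p.
- by rewrite coprimepMl cop1.
- by rewrite coprimep_sym coprimep_XsubC nroot_q.
Qed.

(* X^P - z^P has a simple root at z and no other root in s. *)
Lemma dvdp_prod_XsubC_comp_Xn (F : numFieldType) (s : seq F) (P : nat)
    (g : {poly F}) :
    (0 < P)%N -> 0 \notin s -> {in s &, injective (fun z => z ^+ P)} ->
    \prod_(z <- s) ('X - z%:P) %| g \Po 'X^P ->
  \prod_(z <- s) ('X - (z ^+ P)%:P) %| g.
Proof.
move=> P_gt0; elim: s g => [|z s IHs] g; first by move=> _ _ _; rewrite big_nil dvd1p.
rewrite inE negb_or eq_sym !big_cons => /andP[nz_z s'0] inj_s dv_g.
have /factor_theorem[g1 Dg] : root g (z ^+ P).
  have : root (g \Po 'X^P) z.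
    by rewrite -dvdp_XsubCl; apply: dvdp_trans dv_g; apply: dvdp_mulIl.
  by rewrite root_comp hornerXn.
pose Q := \sum_(i < P) 'X^(P.-1 - i) * z%:P ^+ i.
have DQ : 'X^P - (z ^+ P)%:P = ('X - z%:P) * Q by rewrite polyC_exp subrXX.
rewrite Dg mulrC dvdp_mul2r ?polyXsubC_eq0 //; apply: IHs => //.
  by move=> x y s_x s_y; apply: inj_s; rewrite inE ?s_x ?s_y orbT.
move: dv_g; rewrite Dg comp_polyM comp_polyB comp_polyX comp_polyC DQ.
rewrite mulrCA dvdp_mul2l ?polyXsubC_eq0 // mulrC Gauss_dvdpr //.
apply: coprimep_prod_XsubC => x s_x; have [-> | ne_xz] := eqVneq x z.
  rewrite /root horner_sum (eq_bigr (fun=> z ^+ P.-1)); last first.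
    move=> i _; rewrite -polyC_exp hornerM hornerXn hornerC -exprD subnK //.
    by have := ltn_ord i; lia.
  by rewrite sumr_const card_ord mulrn_eq0 negb_or -lt0n P_gt0 /= expf_neq0.
apply: contra ne_xz => /rootP Qx0; apply/eqP/inj_s; rewrite ?inE ?eqxx ?s_x ?orbT //.
have := congr1 (horner^~ x) DQ.
by rewrite !hornerE Qx0 mulr0 => /eqP; rewrite subr_eq0 => /eqP.
Qed.

(** Roots are listed with multiplicity, so that their linear factors recover the whole polynomial
    even when it has multiple roots. *)
Definition chi_roots k r : seq algC :=
  sval (closed_field_poly_normal (map_poly intr (charpol k r) : {poly algC})).

Lemma charpolE k r :
  map_poly intr (charpol k r) = \prod_(z <- chi_roots k r) ('X - z%:P).
Proof.
rewrite /chi_roots; case: closed_field_poly_normal => s /= Ds.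
by rewrite {1}Ds (monicP (monic_map _ (charpol_monic k r))) scale1r.
Qed.

Lemma size_chi_roots k r : size (chi_roots k r) = k.
Proof.
apply: succn_inj; rewrite -(size_charpol k r).
rewrite -(size_prod_XsubC (chi_roots k r) id) -charpolE.
by rewrite size_map_inj_poly //; apply: intr_inj.
Qed.

Lemma root_charpol k r (z : algC) :
  (z \in chi_roots k r) = root (map_poly intr (charpol k r)) z.
Proof. by rewrite charpolE root_prod_XsubC. Qed.

Lemma chi_roots_neq0 k r : (0 < k)%N -> r k != 0 -> 0 \notin chi_roots k r.
Proof.
move=> k_gt0 nz_rk; rewrite root_charpol /root horner_coef0 coef_map.
by rewrite -(subnn k) coef_charpol ?k_gt0 //= intr_eq0 oppr_eq0.
Qed.

Lemma root_recurrence_poly k r (z : algC) : z != 0 ->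
  root (map_poly intr (charpol k r)) z ->
  root (map_poly intr (recurrence_poly k r)) z^-1.
Proof.
move=> nz_z; rewrite /root /charpol /recurrence_poly !rmorphB !rmorph_sum /=.
rewrite rmorph1 map_polyXn !hornerE !horner_sum => chi0.
rewrite -(mulrI_eq0 _ (lregP (expf_neq0 k nz_z))) mulrBr mulr1 mulr_sumr.
apply: etrans chi0; congr (_ == 0); congr (_ - _); apply: eq_big_nat => i /andP[_ le_ik].
rewrite !map_polyZ !map_polyXn !hornerZ !hornerXn mulrCA; congr (_ * _).
by rewrite exprVn expfB_cond // (negPf nz_z).
Qed.

(** The inverses of two roots with equal [P]-th powers are roots of [recurrence_poly k r] whose
    ratio is a [P]-th root of unity. *)
Lemma chi_roots_expr_inj a k r P :
    (1 < k)%N -> minimal_recurrence a k r -> ~ degenerate a -> (0 < P)%N ->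
  {in chi_roots k r &, injective (fun z => z ^+ P)}.
Proof.
move=> k_gt1 min_a nd_a P_gt0 z w s_z s_w eq_zw; apply/eqP/negP => /negP ne_zw.
have [[_ nz_rk _] _] := min_a.
have s'0 := chi_roots_neq0 (ltnW k_gt1) nz_rk.
have nz_z : z != 0 by apply: contraNneq s'0 => <-.
have nz_w : w != 0 by apply: contraNneq s'0 => <-.
apply: nd_a; exists k, r; split=> //; exists z^-1, w^-1; split.
- by apply: root_recurrence_poly; rewrite -?root_charpol.
- by apply: root_recurrence_poly; rewrite -?root_charpol.
- by rewrite (inj_eq invr_inj).
- exists P => //; apply/unity_rootP.
  by rewrite invrK exprMn exprVn eq_zw mulVf ?expf_neq0.
Qed.

(** * The matrix of terms along a progression *)

(** Polynomials in the shift commute, so [act h a] obeys the recurrence of [a]. *)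
Lemma act_eq0_init a k r h :
    satisfies_recurrence a k r -> (forall i, (i < k)%N -> act h a i = 0) ->
  act h a =1 (fun=> 0).
Proof.
move=> rec_a h0; set u := act h a.
have chi_u n : act (charpol k r) u n = 0.
  rewrite -actM mulrC; apply: act_mull_eq0 => m; exact: act_charpol.
elim/ltn_ind=> n IHn; have [/h0 //|le_kn] := ltnP n k.
have := chi_u (n - k)%N; rewrite /act size_charpol big_ord_recr /= subnK //.
have := charpol_monic k r; rewrite monicE lead_coefE size_charpol => /eqP ->.
rewrite mul1r big1 ?add0r // => i _; rewrite IHn ?mulr0 //.
by have := ltn_ord i; lia.
Qed.

Lemma map_charpol_dvdp k r h :
    Pdiv.Ring.rmodp h (charpol k r) = 0 ->
  \prod_(z <- chi_roots k r) ('X - z%:P) %| (map_poly intr h : {poly algC}).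
Proof.
move=> h_chi; rewrite [h](Pdiv.RingMonic.rdivp_eq (charpol_monic k r)) h_chi addr0.
by rewrite -charpolE rmorphM dvdp_mull.
Qed.

Lemma act_mod_charpol a k r h n : satisfies_recurrence a k r ->
  act h a n = \sum_(i < k) (Pdiv.Ring.rmodp h (charpol k r))`_i * a (n + i)%N.
Proof.
move=> rec_a; have mon_chi := charpol_monic k r.
rewrite {1}[h](Pdiv.RingMonic.rdivp_eq mon_chi) actD act_mull_eq0 ?add0r.
  apply: act_widen; rewrite -ltnS -(size_charpol k r).
  by rewrite Pdiv.Ring.ltn_rmodp monic_neq0.
by move=> m; apply: act_charpol.
Qed.

Definition step_matrix (a : nat -> int) (k P : nat) : 'M[int]_k :=
  \matrix_(m < k, i < k) a (P * m + i)%N.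

(** A left kernel vector gives [g] of degree less than [k] such that [g(X^P)] annihilates [a]. The
    characteristic polynomial then divides [g(X^P)], so the product of [X - z^P] over its [k] roots
    [z] divides [g], and [g = 0]. *)
Lemma det_step_matrix_neq0 a k r P :
    (1 < k)%N -> minimal_recurrence a k r -> ~ degenerate a -> (0 < P)%N ->
  \det (step_matrix a k P) != 0.
Proof.
move=> k_gt1 min_a nd_a P_gt0; have [rec_a _] := min_a; have [_ nz_rk _] := rec_a.
apply/det0P => -[v nz_v vK0].
pose g := \sum_(m < k) v 0 m *: 'X^m : {poly int}.
have g_m (m : 'I_k) : g`_m = v 0 m.
  rewrite coef_sum (bigD1 m) //= coefZ coefXn eqxx mulr1 big1 ?addr0 // => j ne_jm.
  rewrite coefZ coefXn (_ : _ == _ = false) ?mulr0 //.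
  by apply/eqP => /val_inj /esym/eqP; apply/negP.
have size_g : (size g <= k)%N.
  apply: (leq_trans (size_sum _ _ _)); apply/bigmax_leqP => m _.
  by apply: leq_trans (size_scale_leq _ _) _; rewrite size_polyXn.
have ga0 : act (g \Po 'X^P) a =1 (fun=> 0).
  apply: (act_eq0_init rec_a) => i lt_ik.
  rewrite /g rmorph_sum act_sum /=; have /matrixP/(_ 0 (Ordinal lt_ik)) := vK0.
  rewrite !mxE => {2}<-; apply: eq_bigr => m _; rewrite mxE /=.
  by rewrite linearZ /= rmorphXn /= comp_polyX -exprM actZ actXn addnC.
have := map_charpol_dvdp (annihilator_mod_charpol k_gt1 min_a ga0).
rewrite map_comp_poly map_polyXn => /dvdp_prod_XsubC_comp_Xn.
move=> /(_ P_gt0 (chi_roots_neq0 (ltnW k_gt1) nz_rk)).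
move=> /(_ (chi_roots_expr_inj k_gt1 min_a nd_a P_gt0)) dv_g.
have g0 : g = 0.
  apply: contraTeq dv_g => nz_g; rewrite gtNdvdp //.
    by rewrite map_poly_eq0_id0 ?intr_eq0 ?lead_coef_eq0.
  rewrite size_prod_XsubC size_chi_roots ltnS.
  by rewrite size_map_inj_poly //; apply: intr_inj.
by case/eqP: nz_v; apply/rowP => m; rewrite -g_m g0 coef0 mxE.
Qed.

Lemma dvdz_det_mulmx n (A : 'M[int]_n) (v : 'cV[int]_n) (q : int) :
  (forall i, (q %| (A *m v) i ord0)%Z) -> forall i, (q %| \det A * v i ord0)%Z.
Proof.
move=> q_Av i; have -> : \det A * v i ord0 = (\adj A *m (A *m v)) i ord0.
  by rewrite mulmxA mul_adj_mx mul_scalar_mx mxE.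
by rewrite mxE; apply: rpred_sum => j _; apply: dvdz_mull.
Qed.

(** The step matrix sends the coefficients of the remainder to the values of [act h a] at multiples
    of [P]; the adjugate inverts it up to the determinant. A progression starting elsewhere is
    reached through a power of ['X] in [h]. *)
Lemma dvdz_act_mod_charpol a k r P h q :
    satisfies_recurrence a k r ->
    (forall m, (m < k)%N -> (q %| act h a (P * m)%N)%Z) ->
  forall i, (i < k)%N ->
  (q %| \det (step_matrix a k P) * (Pdiv.Ring.rmodp h (charpol k r))`_i)%Z.
Proof.
move=> rec_a q_h i lt_ik; set f := Pdiv.Ring.rmodp h _.
have := @dvdz_det_mulmx k (step_matrix a k P) (\col_(i < k) f`_i) q.
move=> /(_ _ (Ordinal lt_ik)); rewrite mxE; apply=> m.
rewrite mxE (eq_bigr (fun i : 'I_k => f`_i * a (P * m + i)%N)).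
  by rewrite -act_mod_charpol ?q_h.
by move=> j _; rewrite !mxE mulrC.
Qed.

(** * Algebraic integers and the Newton slope *)

Lemma Aint_exprn (x : algC) n : (0 < n)%N -> x ^+ n \in Aint -> x \in Aint.
Proof.
move=> n_gt0 Axn; have size_Xn : (1 < size ('X^n : {poly algC}))%N.
  by rewrite size_polyXn ltnS.
apply: (@root_monic_Aint (minCpoly (x ^+ n) \Po 'X^n)).
- by rewrite root_comp hornerXn root_minCpoly.
- rewrite monicE lead_coef_comp // lead_coefXn expr1n mulr1 -monicE.
  exact: minCpoly_monic.
- by rewrite polyOver_comp ?polyOverXn.
Qed.

(** The coefficient of ['X^j] is homogeneous of degree [size s - j] in the roots, whence the
    exponent of [q]. *)
Lemma Aint_coef_prod_XsubC (s : seq algC) (q : algC) j :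
    q != 0 -> {in s, forall z, z / q \in Aint} -> (j <= size s)%N ->
  (\prod_(z <- s) ('X - z%:P))`_j / q ^+ (size s - j) \in Aint.
Proof.
move=> nz_q; elim: s j => [|z s IHs] j Aq le_js.
  by move: le_js; rewrite leqn0 => /eqP ->; rewrite big_nil coef1 divr1 Aint1.
have {}IHs := IHs _ (fun x sx => Aq x (mem_behead (sx : x \in behead (z :: s)))).
have Az : z / q \in Aint by rewrite Aq ?mem_head.
rewrite big_cons mulrBl coefB coefXM coefCM mulrBl rpredB //=.
  by case: j le_js => [|j] le_js; rewrite ?mul0r ?Aint0 // subSS IHs.
have [-> | ne_j] := eqVneq j (size s).+1.
  by rewrite nth_default ?mulr0 ?mul0r ?Aint0 // size_prod_XsubC.
have {le_js ne_j} le_js : (j <= size s)%N by rewrite /= in le_js; lia.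
rewrite subSn // exprS invfM mulrACA rpredM //; exact: IHs.
Qed.

(** Put [q = p^(E/n)]. For each root [z] the power [(z / q)^n] is the remainder of ['X^n] at [z]
    divided by [p^E], so [z / q] is an algebraic integer. Up to sign [r t] is the elementary
    symmetric function of degree [t] of the roots, so the rational number [(r t)^n / p^(E t)] is an
    algebraic integer, hence an integer. *)
Lemma newton_slope_bound k r p n E t :
    prime p -> (0 < n)%N -> (0 < t <= k)%N -> r t != 0 ->
    (forall i, (i < k)%N ->
      ((p ^ E)%N %| (Pdiv.Ring.rmodp 'X^n (charpol k r))`_i)%Z) ->
  (E * t <= n * logn p `|r t|)%N.
Proof.
move=> p_pr n_gt0 /andP[t_gt0 le_tk] nz_rt pE_f; set f := Pdiv.Ring.rmodp _ _ in pE_f.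
have p_gt0 := prime_gt0 p_pr.
pose q : algC := n.-root (p ^ E)%:R.
have qn : q ^+ n = (p ^ E)%:R by rewrite rootCK.
have nz_pE : (p ^ E)%:R != 0 :> algC by rewrite pnatr_eq0 -lt0n expn_gt0 p_gt0.
have nz_q : q != 0 by rewrite rootC_eq0.
have Aq : {in chi_roots k r, forall z, z / q \in Aint}.
  move=> z; rewrite root_charpol => chi_z0.
  have Az : z \in Aint.
    apply: root_monic_Aint chi_z0 (monic_map _ (charpol_monic _ _)) _.
    by apply/polyOverP => i; rewrite coef_map intr_int.
  apply: (Aint_exprn n_gt0); rewrite exprMn exprVn qn.
  have -> : z ^+ n = (map_poly intr f).[z].
    rewrite -hornerXn -(map_polyXn intr).
    rewrite (Pdiv.RingMonic.rdivp_eq (charpol_monic k r) 'X^n) -/f.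
    by rewrite rmorphD rmorphM /= hornerD hornerM (rootP chi_z0) mulr0 add0r.
  rewrite horner_coef mulr_suml rpred_sum // => i _; rewrite mulrAC rpredM ?rpredX //.
  rewrite coef_map /=; have [lt_ik | le_ki] := ltnP i k.
    have /dvdzP[c ->] := pE_f i lt_ik.
    by rewrite rmorphM /= -pmulrn mulfK // Aint_int.
  rewrite nth_default ?mul0r ?Aint0 // (leq_trans _ le_ki) // -ltnS.
  by rewrite -(size_charpol k r) Pdiv.Ring.ltn_rmodp monic_neq0 ?charpol_monic.
have : (r t ^+ n)%:~R / ((p ^ E)%:R ^+ t) \in Aint.
  rewrite -qn -exprM mulnC exprM -exprVn rmorphXn /= -exprMn rpredX //.
  rewrite -rpredN -mulNr -rmorphN /= -(@coef_charpol k) ?t_gt0 //.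
  rewrite -coef_map charpolE.
  have := @Aint_coef_prod_XsubC (chi_roots k r) q (k - t) nz_q Aq.
  by rewrite size_chi_roots leq_subr subKn //; apply.
move/Cint_rat_Aint => /(_ _)/intrP[|c Dc].
  by rewrite rpred_div ?rpredX ?rpred_int ?rpred_nat.
have {Dc} Dc : r t ^+ n = c * (p ^ (E * t))%N.
  apply: (@intr_inj algC).
  rewrite rmorphM /= -Dc -pmulrn expnM [in RHS](natrX _ (p ^ E)%N) mulfVK //.
  by rewrite expf_neq0.
have : (p ^ (E * t) %| `|r t ^+ n|)%N by rewrite Dc abszM dvdn_mull.
rewrite pfactor_dvdn // ?absz_gt0 ?expf_neq0 //.
by rewrite abszX lognX.
Qed.

(** * Periodicity modulo an integer *)

Lemma eventually_periodic (T : finType) (u : nat -> T) :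
    (forall m n, u m = u n -> u m.+1 = u n.+1) ->
  exists n1 P, (0 < P)%N /\ forall n, (n1 <= n)%N -> u (n + P)%N = u n.
Proof.
move=> step_u; pose f (i : 'I_#|T|.+1) := u i.
have /injectivePn[i [j ne_ij eq_ij]] : ~~ injectiveb f.
  apply/negP => /injectiveP/leq_card; rewrite card_ord; lia.
wlog lt_ij : i j ne_ij eq_ij / (i < j)%N.
  move=> W; have := ne_ij; rewrite neq_ltn => /orP[] lt; first exact: W lt.
  by apply: (W j i) => //; rewrite eq_sym.
exists i, (j - i)%N; split=> [|n le_in]; first by rewrite subn_gt0.
rewrite -(subnK le_in) -addnA subnKC ?(ltnW lt_ij) //.
by elim: (n - i)%N => [|d IHd]; [rewrite !add0n | rewrite !addSn; apply: step_u].
Qed.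

Lemma intr_Zp_eq0 (q : nat) (x : int) : (1 < q)%N ->
  (x%:~R == 0 :> 'Z_q) = (q%:Z %| x)%Z.
Proof.
move=> q_gt1; have natr0 (n : nat) : (n%:R == 0 :> 'Z_q) = (q %| n)%N.
  by rewrite -val_eqE /= val_Zp_nat.
rewrite [x]intEsign rmorphM rmorphXn /= rmorphN1 -pmulrn.
by rewrite mulrI_eq0 ?natr0; [rewrite dvdzE abszMsign | apply/lregX/lregN/lreg1].
Qed.

Lemma recurrence_periodic_mod (q t k : nat) (c : nat -> int)
    (rho : nat -> nat -> int) :
    (1 < q)%N -> (0 < t)%N -> (0 < k)%N ->
    (forall n j, (0 < j <= k)%N -> rho (n + t)%N j = rho n j) ->
    (forall n, c (n + k)%N = \sum_(1 <= j < k.+1) rho n j * c (n + k - j)%N) ->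
  exists n1 P, [/\ (0 < P)%N, (t %| P)%N
    & forall n m, (n1 <= n)%N -> (q%:Z %| c (n + P * m)%N - c n)%Z].
Proof.
move=> q_gt1 t_gt0 k_gt0 per_rho rec_c.
(* The state holds [n] modulo [t] besides [k] successive terms, so that it determines the
   coefficients [rho n j] and with them the next state. *)
pose u n : 'I_t * {ffun 'I_k -> 'Z_q} :=
  (Ordinal (ltn_pmod n t_gt0), [ffun i : 'I_k => (c (n + i)%N)%:~R]).
have rho_mod n j : (0 < j <= k)%N -> rho n j = rho (n %% t)%N j.
  move=> j_k; rewrite {1}(divn_eq n t) addnC.
  by elim: (n %/ t)%N => [|d IHd]; rewrite ?addn0 // mulSn addnCA addnC per_rho.
have uP m n : u m = u n ->
    m = n %[mod t] /\
    forall i, (i < k)%N -> (c (m + i)%N)%:~R = (c (n + i)%N)%:~R :> 'Z_q.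
  case=> eq_mod /ffunP eq_c; split=> // i lt_ik.
  by have := eq_c (Ordinal lt_ik); rewrite !ffunE.
have [|n1 [P [P_gt0 per_u]]] := @eventually_periodic _ u.
  move=> m n /uP[eq_mod eq_c]; congr (_, _).
    by apply/val_inj; rewrite /= -addn1 -modnDml eq_mod modnDml addn1.
  apply/ffunP => i; rewrite !ffunE !addSnnS.
  have [lt_ik | ge_ik] := ltnP i.+1 k; first exact: eq_c.
  have -> : i.+1 = k by apply/eqP; rewrite eqn_leq ge_ik ltn_ord.
  rewrite !rec_c !rmorph_sum; apply: eq_big_nat => j j_k /=.
  rewrite ltnS in j_k; rewrite !rmorphM /= rho_mod // eq_mod -rho_mod //.
  by rewrite -!addnBA ?eq_c //; case/andP: j_k => // *; lia.
exists n1, P; split=> // [|n m le_n].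
  have /uP[eq_mod _] := per_u n1 (leqnn _).
  by move/eqP: eq_mod; rewrite -{2}[n1]addn0 eqn_modDl mod0n.
rewrite -intr_Zp_eq0 // rmorphB subr_eq0 /=; apply/eqP.
elim: m => [|m IHm]; first by rewrite muln0 addn0.
rewrite -{}IHm mulnSr addnA.
have /uP[_ /(_ 0%N k_gt0)] := per_u (n + P * m)%N (leq_trans le_n (leq_addr _ _)).
by rewrite !addn0.
Qed.

(** * Valuations along a progression *)

(** The same powers [p^i] with [i <= N] divide [x] and [y], and the valuation of [y] is below
    [N]. *)
Lemma logn_eq_mod p N (x y : int) : prime p ->
    ((p ^ N)%N %| x - y)%Z -> ~~ ((p ^ N)%N %| y)%Z ->
  x != 0 /\ logn p `|x| = logn p `|y|.
Proof.
move=> p_pr dv_xy ndv_y.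
have nz_y : y != 0 by apply: contraNneq ndv_y => ->; rewrite dvdz0.
have dv_iff i : (i <= N)%N -> (p ^ i %| `|x|)%N = (p ^ i %| `|y|)%N.
  move=> le_iN; have dv_i : ((p ^ i)%N %| x - y)%Z.
    by apply: dvdz_trans dv_xy; rewrite dvdzE /= dvdn_exp2l.
  by have := rpredDl y dv_i; rewrite subrK !dvdzE.
have lt_yN : (logn p `|y| < N)%N.
  by move: ndv_y; rewrite dvdzE /= pfactor_dvdn ?absz_gt0 // -ltnNge.
have nz_x : x != 0.
  by apply: contraNneq ndv_y => x0; rewrite dvdzE -dv_iff // x0 dvdn0.
split=> //; apply/eqP; rewrite eqn_leq.
rewrite -[(_ <= logn p `|x|)%N]pfactor_dvdn ?absz_gt0 // dv_iff ?(ltnW lt_yN) //.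
rewrite pfactor_dvdnn andbT leqNgt -pfactor_dvdn ?absz_gt0 // dv_iff //.
by rewrite pfactor_dvdn ?absz_gt0 // ltnn.
Qed.

(* t attains the first slope s/t of the p-adic Newton polygon. *)
Lemma newton_slope_exists k (r : nat -> int) p : (0 < k)%N -> r k != 0 ->
  exists t, [/\ (0 < t <= k)%N, r t != 0 & forall j, (0 < j <= k)%N -> r j != 0 ->
    (logn p `|r t| * j <= logn p `|r j| * t)%N].
Proof.
case: k => // k _ nz_rk.
pose w (i : 'I_k.+1) : rat := (logn p `|r i.+1|)%:R / i.+1%:R.
case: (@arg_minP _ _ _ ord_max (fun i : 'I_k.+1 => r i.+1 != 0) w nz_rk) => i nz_ri min_i.
exists i.+1; split=> //; first exact: (ltn_ord i).
case=> // j lt_jk nz_rj; have := min_i (Ordinal lt_jk : 'I_k.+1) nz_rj.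
by rewrite /w ler_pdivrMr ?ltr0n // mulrAC ler_pdivlMr ?ltr0n // -!natrM ler_nat.
Qed.

(* Dividing a by p to the power of the slope makes the recurrence p-integral,
   at the cost of coefficients that are only periodic. *)
Lemma rescaled_recurrence a k r p t :
    prime p -> satisfies_recurrence a k r -> (0 < t <= k)%N ->
    let s := logn p `|r t| in
    let e n := (s * n %/ t)%N in
    (forall j, (0 < j <= k)%N -> r j != 0 -> (s * j <= logn p `|r j| * t)%N) ->
  exists (c : nat -> int) (rho : nat -> nat -> int),
  [/\ forall n, (p ^ e k)%N%:Z * a n = (p ^ e n)%N%:Z * c n,
      forall n j, (0 < j <= k)%N -> rho (n + t)%N j = rho n j
    & forall n, c (n + k)%N = \sum_(1 <= j < k.+1) rho n j * c (n + k - j)%N].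
Proof.
move=> p_pr [k_gt0 _ rec_a] /andP[t_gt0 le_tk] s e slope.
have p_gt0 := prime_gt0 p_pr.
have le_e m n : (m <= n)%N -> (e m <= e n)%N.
  by move=> le_mn; rewrite leq_div2r // leq_mul2l le_mn orbT.
have e_add_t n : e (n + t)%N = (e n + s)%N by rewrite /e mulnDr divnDMl.
pose rho n j := (r j %/ (p ^ (e (n + k) - e (n + k - j)))%N)%Z.
(* For nonzero [r j] the slope condition bounds its valuation below by [s * j / t]; taking floors,
   this is at least [e (n + k) - e (n + k - j)], so the division is exact. *)
have rhoE n j : (0 < j <= k)%N ->
    r j = rho n j * (p ^ (e (n + k) - e (n + k - j)))%N.
  move=> /[dup] j_k /andP[_ le_jk]; rewrite divzK //.
  have [->|nz_rj] := eqVneq (r j) 0; first exact: dvdz0.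
  rewrite dvdzE pfactor_dvdn ?absz_gt0 // leq_subLR [leqRHS]addnC /e -divnMDl //.
  apply: leq_div2r; rewrite -{1}(@subnK j (n + k)%N); last by lia.
  by rewrite mulnDr [leqLHS]addnC leq_add2r slope.
have pe_split n j : (p ^ e (n + k)%N)%N%:Z =
    (p ^ (e (n + k) - e (n + k - j)))%N%:Z * (p ^ e (n + k - j)%N)%N%:Z.
  by rewrite -PoszM -expnD subnK // le_e // leq_subr.
have termE n j : (0 < j <= k)%N -> (p ^ e k)%N%:Z * (r j * a (n + k - j)%N) =
    rho n j * (p ^ (e (n + k) - e (n + k - j)))%N%:Z
      * ((p ^ e k)%N%:Z * a (n + k - j)%N).
  by move=> j_k; rewrite {1}(rhoE n) // mulrCA.
(* The constant factor [p ^ e k] serves the first [k] terms; the recurrence carries the divisibility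
   on. *)
have dv_a n : ((p ^ e n)%N %| (p ^ e k)%N%:Z * a n)%Z.
  elim/ltn_ind: n => n IHn; have [lt_nk | le_kn] := ltnP n k.
    by rewrite dvdz_mulr // dvdzE /= dvdn_exp2l // le_e // ltnW.
  rewrite -(subnK le_kn) rec_a mulr_sumr big_nat; apply: rpred_sum => j j_k.
  rewrite termE // (pe_split _ j); apply: dvdz_mul; first exact: dvdz_mull.
  by apply: IHn; lia.
pose c n := (((p ^ e k)%N%:Z * a n) %/ (p ^ e n)%N)%Z.
have cE n : (p ^ e k)%N%:Z * a n = (p ^ e n)%N%:Z * c n.
  by rewrite [RHS]mulrC divzK.
exists c, rho; split=> // [n j j_k | n].
  rewrite /rho addnAC e_add_t (_ : n + k + t - j = n + k - j + t)%N; last by lia.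
  by rewrite e_add_t subnDr.
have nz_pe : (p ^ e (n + k)%N)%N%:Z != 0 by rewrite -lt0n expn_gt0 p_gt0.
apply: (mulfI nz_pe); rewrite -cE rec_a !mulr_sumr; apply: eq_big_nat => j j_k.
by rewrite termE // cE (pe_split n j) [rho n j * _]mulrC mulrACA.
Qed.

(** The progression to be refined is arbitrary, so that several primes can be treated in turn. *)
Lemma logn_affine_progression a k r p n0 P :
    (1 < k)%N -> minimal_recurrence a k r -> ~ degenerate a -> prime p ->
    (0 < P)%N ->
  exists i Q A B, (0 < Q)%N /\ forall m,
    a (n0 + P * (i + Q * m))%N != 0 /\
    logn p `|a (n0 + P * (i + Q * m))%N| = (A + B * m)%N.
Proof.
move=> k_gt1 min_a nd_a p_pr P_gt0; have [rec_a _] := min_a.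
have [k_gt0 nz_rk _] := rec_a; have p_gt1 := prime_gt1 p_pr.
have [t [t_k nz_rt slope]] := newton_slope_exists p k_gt0 nz_rk.
have t_gt0 : (0 < t)%N by case/andP: t_k.
have := rescaled_recurrence p_pr rec_a t_k slope.
set s := logn p _; cbv zeta; set e := fun n : nat => (s * n %/ t)%N.
case=> c [rho [cE per_rho rec_c]].
set D := \det (step_matrix a k P).
have nz_D : D != 0 by exact: det_step_matrix_neq0 k_gt1 min_a nd_a P_gt0.
(* [N] makes up for the loss [h] from the determinant and [e k] from the rescaling; the extra 1
   matches the one in [E] below. *)
pose h := logn p `|D|; pose N := (e k + h + 1)%N.
have N_gt0 : (0 < N)%N by rewrite /N addn1.
have q_gt1 : (1 < p ^ N)%N by rewrite -(exp1n N) ltn_exp2r.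
have [n1 [R [R_gt0 t_R per_c]]] :=
  recurrence_periodic_mod q_gt1 t_gt0 k_gt0 per_rho rec_c.
(* [n1.+1] puts [N0] past the preperiod and makes it positive; [E] is the least integer above
   [s * N0 / t]. *)
pose N0 := (n0 + P * n1.+1)%N; pose E := (e N0).+1.
(* Otherwise [p ^ E] divides all coefficients of the remainder of ['X^N0], and [newton_slope_bound]
   gives [E * t <= N0 * s], against the choice of [E]. *)
have [m /andP[lt_mk ndv_a]] : exists m,
    (m < k)%N && ~~ ((p ^ (E + h))%N %| a (N0 + P * m)%N)%Z.
  pose bad := [exists m : 'I_k, ~~ ((p ^ (E + h))%N %| a (N0 + P * m)%N)%Z].
  have [/existsP[m]|] := boolP bad; first by exists m; rewrite ltn_ord.
  rewrite negb_exists => /forallP all_dv.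
  suff : (E * t <= N0 * s)%N.
    by rewrite leqNgt [(N0 * s)%N]mulnC /E ltn_ceil.
  apply: (newton_slope_bound p_pr _ t_k nz_rt) => [|i lt_ik]; first by rewrite /N0; lia.
  have := @dvdz_act_mod_charpol a k r P 'X^N0 (p ^ (E + h))%N rec_a.
  move=> /(_ _ i lt_ik); set f := _`_i.
  have [->|nz_f] := eqVneq f 0; first by rewrite dvdz0.
  rewrite -/D !dvdzE /= !pfactor_dvdn ?absz_gt0 ?mulf_neq0 // abszM lognM ?absz_gt0 //.
  rewrite -/h [leqRHS]addnC leq_add2r; apply=> m lt_mk.
  by have := all_dv (Ordinal lt_mk); rewrite negbK actXn addnC.
pose n2 := (N0 + P * m)%N.
have ndv_c : ~~ ((p ^ N)%N %| c n2)%Z.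
  apply: contra ndv_a => dv_c; have : ((p ^ (e n2 + N))%N %| (p ^ e k)%N%:Z * a n2)%Z.
    by rewrite cE expnD PoszM dvdz_mul.
  have -> : (e n2 + N = e k + (e n2 + h + 1))%N by rewrite /N; lia.
  rewrite expnD PoszM dvdz_mul2l -?lt0n ?expn_gt0 ?prime_gt0 //.
  apply: dvdz_trans; rewrite dvdzE /= dvdn_exp2l // /E.
  have : (e N0 <= e n2)%N by rewrite leq_div2r // leq_mul2l leq_addr orbT.
  lia.
(* From [n2] on, multiples of [R] preserve the valuation of [c], while each step [R = T * t] raises
   [e] by exactly [s * T]. This gives the slope [s * (T * P)]. *)
have [T DT] := dvdnP t_R.
exists (n1.+1 + m)%N, R, (logn p `|a n2|), (s * (T * P))%N; split=> // d.
have -> : (n0 + P * (n1.+1 + m + R * d) = n2 + R * (P * d))%N by rewrite /n2 /N0; lia.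
have le_n1 : (n1 <= n2)%N by rewrite /n2 /N0; nia.
have pos_pe n : (0 < p ^ e n)%N by rewrite expn_gt0 prime_gt0.
have val_c n : c n != 0 ->
    a n != 0 /\ (e k + logn p `|a n| = e n + logn p `|c n|)%N.
  move=> nz_c; have := cE n; have [->|nz_a] := eqVneq (a n) 0.
    move=> /esym/eqP; rewrite mulr0 mulf_eq0 (negPf nz_c) orbF.
    by rewrite eqz_nat -leqn0 leqNgt pos_pe.
  move=> /(congr1 (fun x : int => logn p `|x|)); rewrite !abszM /=.
  rewrite !lognM ?absz_gt0 ?pos_pe //.
  by rewrite !pfactorK.
have [nz_c2 _] := logn_eq_mod p_pr (per_c n2 0%N le_n1) ndv_c.
have [nz_cd Dc] := logn_eq_mod p_pr (per_c n2 (P * d)%N le_n1) ndv_c.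
rewrite muln0 addn0 in nz_c2; have [_ val_a2] := val_c _ nz_c2.
have [nz_a val_a] := val_c _ nz_cd; split=> //.
have : e (n2 + R * (P * d))%N = (s * (T * P) * d + e n2)%N.
  by rewrite /e -divnMDl // DT; congr (_ %/ _)%N; ring.
lia.
Qed.

(** Affine functions stay affine along a subprogression, so the primes already treated survive the
    next refinement. *)
Lemma logn_affine_progression_seq a k r (ps : seq nat) :
    (1 < k)%N -> minimal_recurrence a k r -> ~ degenerate a -> all prime ps ->
  exists n0 P, (0 < P)%N /\ forall p, p \in ps ->
    exists A B, forall m, logn p `|a (n0 + P * m)%N| = (A + B * m)%N.
Proof.
move=> k_gt1 min_a nd_a; elim: ps => [|p ps IHps] /=; first by exists 0%N, 1%N.
case/andP=> p_pr /IHps[n0 [P [P_gt0 logn_ps]]].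
have [i [Q [A [B [Q_gt0 logn_p]]]]] :=
  logn_affine_progression n0 k_gt1 min_a nd_a p_pr P_gt0.
have DE m : (n0 + P * i + P * Q * m = n0 + P * (i + Q * m))%N by lia.
exists (n0 + P * i)%N, (P * Q)%N; split=> [|q]; first by rewrite muln_gt0 P_gt0.
rewrite inE => /predU1P[-> | /logn_ps[A' [B' logn_q]]].
  by exists A, B => m; rewrite DE; case: (logn_p m).
exists (A' + B' * i)%N, (B' * Q)%N => m; rewrite DE logn_q; lia.
Qed.

(** * Geometric subsequences *)

(* The characteristic polynomial would divide X^n0 (c0 X^P - c1), so that
   c0 X - c1 would have the P-th powers of all k > 1 roots as roots. *)
Lemma no_geometric_subsequence a k r n0 P (c0 c1 : int) :
    (1 < k)%N -> minimal_recurrence a k r -> ~ degenerate a -> (0 < P)%N ->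
    c0 != 0 ->
  ~ forall m, c0 * a (n0 + P * m.+1)%N = c1 * a (n0 + P * m)%N.
Proof.
move=> k_gt1 min_a nd_a P_gt0 nz_c0 geom_a; have [rec_a _] := min_a.
have [k_gt0 nz_rk _] := rec_a.
pose h : {poly int} := 'X^n0 * ((c0 *: 'X - c1%:P) \Po 'X^P).
have Dh : h = c0 *: 'X^(n0 + P) - c1 *: 'X^n0.
  rewrite /h comp_polyB comp_polyZ comp_polyX comp_polyC mulrBr.
  by rewrite mulrC -scalerAl -exprD addnC mulrC mul_polyC.
have h0 m : act h a (P * m) = 0.
  rewrite Dh actD actN !actZ !actXn; apply/eqP; rewrite subr_eq0.
  by rewrite addnCA -mulnSr geom_a addnC.
have {h0} : Pdiv.Ring.rmodp h (charpol k r) = 0.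
  apply/polyP => i; rewrite coef0; have [lt_ik | le_ki] := ltnP i k.
    (* With modulus 0, divisibility is vanishing, and the nonzero determinant cancels. *)
    have /(_ _ i lt_ik) := @dvdz_act_mod_charpol a k r P h 0 rec_a.
    rewrite dvd0z mulf_eq0 (negPf (det_step_matrix_neq0 k_gt1 min_a nd_a P_gt0)).
    by move=> f0; apply/eqP/f0 => m _; rewrite h0 dvdzz.
  rewrite nth_default // (leq_trans _ le_ki) // -ltnS -(size_charpol k r).
  by rewrite Pdiv.Ring.ltn_rmodp monic_neq0 ?charpol_monic.
move/map_charpol_dvdp; rewrite rmorphM /= map_polyXn Gauss_dvdpr; last first.
  apply: coprimep_prod_XsubC => z s_z; rewrite /root hornerXn expf_eq0 negb_and.
  by rewrite (memPn (chi_roots_neq0 k_gt0 nz_rk)) ?orbT.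
rewrite map_comp_poly map_polyXn => /dvdp_prod_XsubC_comp_Xn.
move=> /(_ P_gt0 (chi_roots_neq0 k_gt0 nz_rk)).
move=> /(_ (chi_roots_expr_inj k_gt1 min_a nd_a P_gt0)) /dvdp_leq.
have size_lin : size (map_poly intr (c0 *: 'X - c1%:P) : {poly algC}) = 2%N.
  rewrite size_map_inj_poly //; last exact: intr_inj.
  by rewrite size_polyDl size_scale ?size_polyX // size_polyN size_polyC; case: eqP.
rewrite size_lin -size_poly_eq0 size_lin size_prod_XsubC size_chi_roots.
by move/(_ isT); rewrite ltnS leqNgt k_gt1.
Qed.

(** * Infinitude of the prime divisors *)

Local Open Scope classical_set_scope.

Theorem theorem3p4 (k : nat) (a : nat -> int) (r : nat -> int)
    (hk : (1 < k)%N) (har : minimal_recurrence a k r)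
    (hnd : ~ degenerate a) :
  infinite_set [set p : nat | prime_divisor a p].
Proof.
move=> /finite_seqP[ps' Dps']; pose ps := [seq p <- ps' | prime p].
have ps_pr : all prime ps := filter_all _ _.
have in_ps p : prime p -> forall n, (p %| `|a n|)%N -> p \in ps.
  move=> p_pr n p_dv; rewrite mem_filter p_pr /=.
  have : [set p : nat | prime_divisor a p] p by split=> //; exists n.
  by rewrite Dps'.
have [n0 [P [P_gt0 logn_ps]]] := logn_affine_progression_seq hk har hnd ps_pr.
(* [l] exceeds all of [ps], hence divides no term, and exceeds 2, hence separates signs. *)
have [l lt_l l_pr] := prime_above (\max_(p <- ps) p).+2.
have l_ps : l \notin ps.
  apply/negP => ps_l; move: lt_l; rewrite ltnNge ltnW // ltnS ltnW // ltnS.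
  by apply: leq_bigmax_seq.
have l_dv n : ~~ (l %| `|a n|)%N by apply: contra l_ps; apply: in_ps.
have nz_a n : a n != 0 by apply: contraNneq (l_dv n) => ->; rewrite absz0 dvdn0.
have [rec_a _] := har; have [k_gt0 _ rec] := rec_a.
have [//|n1 [Q [Q_gt0 _ per_a]]] :=
  @recurrence_periodic_mod l 1 k a (fun=> r) (prime_gt1 l_pr) isT k_gt0 _ rec.
pose c m := a (n0 + P * n1 + P * Q * m)%N.
have le_n1 : (n1 <= n0 + P * n1)%N by nia.
have per_c m : (l %| c m - c 0%N)%Z.
  by have := per_a _ (P * m)%N le_n1; rewrite mulnCA mulnA /c muln0 addn0.
(* For [p] in [ps] the exponents are affine in the index, and the indices add up to [m + 1] on both
   sides; any other [p] has exponent 0. *)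
have logn_c p m : (logn p `|(c m.+1 * c 0%N)%R| = logn p `|(c 1%N * c m)%R|)%N.
  rewrite !abszM !lognM ?absz_gt0 ?nz_a //; have [p_ps | p'ps] := boolP (p \in ps).
    have [A [B logn_p]] := logn_ps p p_ps.
    have DE n : (n0 + P * n1 + P * Q * n = n0 + P * (n1 + Q * n))%N by lia.
    rewrite /c !DE !logn_p; lia.
  have logn0 n : logn p `|c n| = 0%N.
    apply/eqP; rewrite eqn0Ngt logn_gt0 mem_primes absz_gt0 nz_a /=.
    by apply: contra p'ps => /andP[p_pr]; apply: in_ps.
  by rewrite !logn0.
apply: (@no_geometric_subsequence a k r (n0 + P * n1) (P * Q) (c 0%N) (c 1%N)) => //.
- by rewrite muln_gt0 P_gt0.
- exact: nz_a.
move=> m; rewrite -/(c m.+1) -/(c m) mulrC.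
have eq_abs : `|(c m.+1 * c 0%N)%R|%N = `|(c 1%N * c m)%R|%N.
  by apply: eqn_from_log => [||p]; rewrite ?absz_gt0 ?mulf_neq0 ?nz_a ?logn_c.
have /orP[/eqP //|/eqP eq_opp] :
    (c m.+1 * c 0%N == c 1%N * c m) || (c m.+1 * c 0%N == - (c 1%N * c m)).
  by rewrite -eqr_norm2 -!abszE eq_abs.
(* The two products are congruent mod l, and l is odd and prime to both. *)
have : (l %| 2%:Z * (c 0%N * c 0%N))%Z.
  have -> : 2%:Z * (c 0%N * c 0%N) = - ((c m.+1 - c 0%N) * c 0%N)
      - ((c 1%N - c 0%N) * c m + (c m - c 0%N) * c 0%N).
    move: eq_opp; lia.
  by rewrite rpredB ?rpredN ?rpredD // dvdz_mulr.
rewrite dvdzE !abszM !Euclid_dvdM // (negPf (l_dv _)) !orbF => l_2.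
have : (l <= 2)%N by apply: dvdn_leq.
by rewrite leqNgt (leq_ltn_trans _ lt_l).
Qed.
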